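(* Let $V$ be a finite-dimensional vector space over a field $\mathbb{K}$ and let $\mathcal{F}=\{\langle\cdot,\cdot\rangle_i\}_{i\in I\cup\{0\}}$ be a family of inner products on $V$ such that $\langle\cdot,\cdot\rangle_0$ is nondegenerate. Then for each $i\in I$ there is a linear map $T_i\colon V\to V$ such that $\langle x,y\rangle_i=\langle T_i(x),y\rangle_0$ for all $x,y\in V$. Furthermore, each $T_i$ is a self-adjoint operator of $(V,\langle\cdot,\cdot\rangle_0)$. Moreover: (1) The family $\mathcal{F}$ is simultaneously orthogonalizable if and only if there is a basis $B$ of $V$, orthogonal relative to $\langle\cdot,\cdot\rangle_0$, such that every $T_i$ ($i\in I$) is diagonal relative to $B$. (2) If $\operatorname{char}(\mathbb{K})\neq 2$, the family $\mathcal{F}$ is simultaneously orthogonalizable if and only if $\{T_i\}_{i\in I}$ is a commutative family of diagonalizable endomorphisms of $V$ (that is, $T_iT_j=T_jT_i$ for all $i,j\in I$ and each $T_i$ is diagonalizable over $\mathbb{K}$).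
   Context: An inner product on a $\mathbb{K}$-vector space $V$ means a symmetric bilinear form $V\times V\to\mathbb{K}$ (possibly degenerate). A basis $\{v_j\}$ of $V$ is orthogonal relative to an inner product $\langle\cdot,\cdot\rangle$ if $\langle v_j,v_k\rangle=0$ whenever $j\neq k$ (isotropic basis vectors are allowed). A family of inner products $\{\langle\cdot,\cdot\rangle_i\}$ on $V$ is simultaneously orthogonalizable if there is a single basis of $V$ that is orthogonal relative to every member of the family. A linear map $T\colon V\to V$ is self-adjoint for $\langle\cdot,\cdot\rangle_0$ if $\langle T(x),y\rangle_0=\langle x,T(y)\rangle_0$ for all $x,y\in V$. A linear map is diagonal (diagonalizable) relative to a basis $B$ if each element of $B$ is an eigenvector of it. *)

(* Defs.v *)
From mathcomp Require Import all_boot all_algebra.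

Set Implicit Arguments.
Unset Strict Implicit.
Unset Printing Implicit Defensive.

Import GRing.Theory.
Local Open Scope ring_scope.

(* Inner products are the elements of {symmetric V}, i.e. symmetric bilinear   *)
(* forms V -> V -> K, possibly degenerate.                                     *)

Section Definitions.

Variables (K : fieldType) (V : vectType K).

Definition is_basis (B : (\dim {:V}).-tuple V) : bool := basis_of fullv B.

(* Nothing is required when j = k: basis vectors may be isotropic. *)
Definition orthogonal_wrt (f : {symmetric V}) (B : (\dim {:V}).-tuple V) : Prop :=
  forall j k : 'I_(\dim {:V}), j != k -> f (tnth B j) (tnth B k) = 0.

Definition simultaneously_orthogonalizable (J : Type) (F : J -> {symmetric V}) :
    Prop :=
  exists B : (\dim {:V}).-tuple V,
    is_basis B /\ (forall j : J, orthogonal_wrt (F j) B).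

Definition self_adjoint (f : {symmetric V}) (T : 'End(V)) : Prop :=
  forall x y : V, f (T x) y = f x (T y).

Definition eigenvector (T : 'End(V)) (v : V) : Prop :=
  v != 0 /\ (exists a : K, T v = a *: v).

Definition diagonal_wrt (B : (\dim {:V}).-tuple V) (T : 'End(V)) : Prop :=
  forall j : 'I_(\dim {:V}), eigenvector T (tnth B j).

Definition diagonalizable_end (T : 'End(V)) : Prop :=
  exists B : (\dim {:V}).-tuple V, is_basis B /\ diagonal_wrt B T.

Definition commutative_family (I : Type) (T : I -> 'End(V)) : Prop :=
  forall i j : I, (T i \o T j)%VF = (T j \o T i)%VF.

End Definitions.

(* Main.v *)
(* Nondegeneracy makes x |-> <x, ->_0 a bijection from V onto its dual, which
   gives T_i. For (2), every eigenprojection of a T_i is a self-adjoint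
   idempotent, and all these projections commute. A stable subspace U splits
   orthogonally as P U + (U cap ker P) along each such P; splitting repeatedly
   reaches subspaces on which every P is 0 or the identity, and there any
   orthogonal basis works, which exists in characteristic other than 2. That
   basis is itself found by splitting, along x |-> (<x, u> / <u, u>) u.
   Excluded middle decides whether some P in the (arbitrary) family splits U. *)

From HB Require Import structures.
Require Import Defs.
From mathcomp Require Import all_boot all_algebra.
From Stdlib Require Import Classical.

Set Implicit Arguments.
Unset Strict Implicit.
Unset Printing Implicit Defensive.

Import GRing.Theory.
Local Open Scope ring_scope.

Section SymmetricForms.

Variables (K : fieldType) (V : vectType K).
Implicit Types (f g : {symmetric V}) (P Q S T : 'End(V)) (U W : {vspace V}).
Implicit Types (X : seq V) (C : V -> Prop).

(** * A symmetric form as a map to the dual space *)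

Lemma sym_formC f x y : f x y = f y x.
Proof. by rewrite hermC expr0 mul1r. Qed.

Lemma sym_formZl f a x y : f (a *: x) y = a * f x y.
Proof. exact: linearZl_LR. Qed.

Lemma sym_formZr f a x y : f x (a *: y) = a * f x y.
Proof. exact: linearZr_LR. Qed.

Lemma nondegenerate_eq0 f x :
  nondegenerate f -> (forall y, f x y = 0) -> x = 0.
Proof.
move=> /eqP f_nd fx0; apply/eqP; rewrite -memv0 -f_nd.
by apply/mem_orthovP => y _; apply: fx0.
Qed.

Definition flat_fun f (x : V) : 'Hom(V, K^o) := linfun (applyr f x : V -> K^o).

Lemma flat_funE f x y : flat_fun f x y = f x y.
Proof. by rewrite lfunE sym_formC. Qed.

Lemma flat_fun_linear f : linear (flat_fun f).
Proof.
move=> a x y; apply/lfunP => z.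
by rewrite add_lfunE scale_lfunE !flat_funE linearPl.
Qed.

HB.instance Definition _ f :=
  GRing.isLinear.Build K V 'Hom(V, K^o) *:%R (flat_fun f) (flat_fun_linear f).

Definition flat f : 'Hom(V, 'Hom(V, K^o)) := linfun (flat_fun f).

Lemma flatE f x y : flat f x y = f x y.
Proof. by rewrite lfunE flat_funE. Qed.

(** Nondegeneracy makes [flat f] injective, and [V] and its dual have the same dimension. *)
Lemma limg_flat f : nondegenerate f -> limg (flat f) = fullv.
Proof.
move=> f_nd; apply/eqP; rewrite eqEdim subvf /= limg_dim_eq.
  by rewrite !dimvf /dim /= muln1.
apply/eqP; rewrite capfv; apply/lker0P => x y /lfunP eq_xy.
apply/eqP; rewrite -subr_eq0; apply/eqP/(nondegenerate_eq0 f_nd) => z.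
by rewrite linearBl /= -!flatE eq_xy subrr.
Qed.

(** As [flat f] is onto, [(flat f)^-1] turns the functional [flat g x] into the vector that
    represents it through [f]. *)
Lemma symmetric_form_representation f g : nondegenerate f ->
  forall x y, g x y = f (((flat f)^-1 \o flat g)%VF x) y.
Proof.
move=> f_nd x y; rewrite -(flatE f) comp_lfunE limg_lfunVK ?flatE //.
by rewrite limg_flat // memvf.
Qed.

(** * Orthogonal bases *)

(** Sequences let the bases of two complementary subspaces be concatenated; [C] is the property
    wanted of each basis vector. *)
Definition has_orthogonal_basis f C U : Prop :=
  exists X, [/\ basis_of U X, pairwise (fun x y => f x y == 0) X &
                {in X, forall x, C x}].

Lemma has_orthogonal_basisT f C : has_orthogonal_basis f C fullv ->
  exists B : (\dim {:V}).-tuple V,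
    [/\ is_basis B, orthogonal_wrt f B & forall j, C (tnth B j)].
Proof.
move=> [X [XB Xo XC]].
have szX : size X == \dim {:V} by rewrite (@size_basis _ _ _ _ (in_tuple X)).
exists (Tuple szX); split => [//|j k|j]; last by apply/XC/(mem_tnth j (Tuple szX)).
have Xlt i i' : (i < i' < size X)%N -> f X`_i X`_i' = 0.
  move=> /andP[lt_ii' lt_i']; apply/eqP; have /pairwiseP := Xo; apply => //.
  exact: ltn_trans lt_i'.
rewrite !(tnth_nth 0) neq_ltn => /orP[] lt_jk; last rewrite sym_formC;
  by rewrite Xlt // lt_jk (eqP szX) /=.
Qed.

Lemma form_orthogonal_basis f n (B : n.-tuple V) k x : basis_of fullv B ->
  (forall i j, i != j -> f (tnth B i) (tnth B j) = 0) ->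
  f x (tnth B k) = coord B k x * f (tnth B k) (tnth B k).
Proof.
move=> BB Bo; rewrite {1}(coord_basis BB (memvf x)) linear_sumlz (bigD1 k) //=.
rewrite big1 => [|i ik].
  by rewrite addr0 sym_formZl (tnth_nth 0).
by rewrite sym_formZl -tnth_nth Bo // mulr0.
Qed.

(** An isotropic vector of an orthogonal basis would be orthogonal to all of [V], so there is none.
    Hence [T (tnth B j)], being orthogonal to [tnth B k], has zero [k]-th coordinate. *)
Lemma orthogonal_diagonal f (B : (\dim {:V}).-tuple V) T :
  nondegenerate f -> is_basis B -> orthogonal_wrt f B ->
  (forall j k, j != k -> f (T (tnth B j)) (tnth B k) = 0) -> diagonal_wrt B T.
Proof.
move=> f_nd BB Bo TB j; split; first exact: basis_not0 BB (mem_tnth j B).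
have Bkk k : f (tnth B k) (tnth B k) != 0.
  apply: contraNneq (basis_not0 BB (mem_tnth k B)) => fkk0.
  apply/eqP/(nondegenerate_eq0 f_nd) => x.
  by rewrite sym_formC (form_orthogonal_basis _ _ BB Bo) fkk0 mulr0.
exists (coord B j (T (tnth B j))).
rewrite {1}(coord_basis BB (memvf (T (tnth B j)))) (bigD1 j) //= big1 => [|k kj].
  by rewrite addr0 -tnth_nth.
have := TB j k; rewrite eq_sym kj (form_orthogonal_basis _ _ BB Bo) => /(_ isT)/eqP.
by rewrite mulf_eq0 (negPf (Bkk k)) orbF => /eqP ->; rewrite scale0r.
Qed.

(** * Self-adjoint idempotents and the splittings they give *)

Definition idempotent_lfun P : Prop := forall x, P (P x) = P x.

(** Write [x] as [P x + (x - P x)]; stability of [U] keeps both terms in [U]. *)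
Lemma idempotent_splitting P U : idempotent_lfun P -> (P @: U <= U)%VS ->
  U = (P @: U + U :&: lker P)%VS /\ directv (P @: U + U :&: lker P).
Proof.
move=> PP PU; split.
  apply/eqP; rewrite eqEsubv subv_add PU capvSl !andbT.
  apply/subvP => x xU; rewrite -(subrK (P x) x) addrC memv_add ?memv_img //.
  rewrite memv_cap memv_ker linearB /= PP subrr eqxx andbT.
  by rewrite memvB // (subvP PU) ?memv_img.
apply/directv_addP/eqP; rewrite -subv0; apply/subvP => x.
rewrite !memv_cap memv0 memv_ker => /and3P[/memv_imgP[y _ ->] _].
by rewrite PP.
Qed.

(** The two pieces are orthogonal: [f (P z) y = f z (P y) = 0] when [P y = 0]. *)
Lemma has_orthogonal_basis_split f C P U :
  self_adjoint f P -> idempotent_lfun P -> (P @: U <= U)%VS ->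
  has_orthogonal_basis f C (P @: U) ->
  has_orthogonal_basis f C (U :&: lker P) -> has_orthogonal_basis f C U.
Proof.
move=> Pf PP PU [X [XB Xo XC]] [Y [YB Yo YC]].
have [eqU dxU] := idempotent_splitting PP PU.
exists (X ++ Y); split.
- by rewrite eqU cat_basis.
- rewrite pairwise_cat Xo Yo !andbT; apply/allrelP => x y xX yY.
  have /memv_imgP[z _ ->] := basis_mem XB xX.
  have := basis_mem YB yY; rewrite memv_cap memv_ker => /andP[_ /eqP Py0].
  by rewrite Pf Py0 linear0r.
- by move=> x; rewrite mem_cat => /orP[/XC | /YC].
Qed.

(* Constantly [0] when [f u u = 0], where division returns [0]. *)
Definition line_proj_fun f u (x : V) : V := (f x u / f u u) *: u.

Lemma line_proj_fun_linear f u : linear (line_proj_fun f u).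
Proof.
move=> a x y; rewrite /line_proj_fun linearPl /= mulrDl scalerDl.
by rewrite scalerA mulrA.
Qed.

HB.instance Definition _ f u :=
  GRing.isLinear.Build K V V *:%R (line_proj_fun f u)
    (line_proj_fun_linear f u).

Definition line_proj f u : 'End(V) := linfun (line_proj_fun f u).

Lemma line_projE f u x : line_proj f u x = (f x u / f u u) *: u.
Proof. by rewrite lfunE. Qed.

Lemma line_proj_self_adjoint f u : self_adjoint f (line_proj f u).
Proof.
move=> x y; rewrite !line_projE sym_formZl sym_formZr /=.
by rewrite (sym_formC f u y) mulrAC [RHS]mulrAC [X in X / _]mulrC.
Qed.

Lemma line_proj_idempotent f u : f u u != 0 -> idempotent_lfun (line_proj f u).
Proof.
by move=> fu x; rewrite !line_projE sym_formZl /= mulfK.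
Qed.

Lemma limg_line_proj f u U : f u u != 0 -> u \in U ->
  (line_proj f u @: U)%VS = <[u]>%VS.
Proof.
move=> fu uU; apply/eqP; rewrite eqEsubv; apply/andP; split; apply/subvP => x.
  by move=> /memv_imgP[y _ ->]; rewrite line_projE memvZ ?memv_line.
move=> /vlineP[k ->]; rewrite memvZ // -[X in X \in _](_ : line_proj f u u = u).
  by rewrite memv_img.
by rewrite line_projE divff // scale1r.
Qed.

(** * Orthogonal bases in characteristic other than 2 *)

(** Polarization: [f (x + y) (x + y)] reduces to twice [f x y]. *)
Lemma isotropic_orthogonal f U : 2%N \notin [pchar K] ->
  {in U, forall x, f x x = 0} -> {in U &, forall x y, f x y = 0}.
Proof.
move=> char2 f0 x y xU yU; have := f0 _ (memvD xU yU).
rewrite hnormD !f0 //= expr0 mul1r !add0r -mulr2n => /eqP.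
rewrite -mulr_natl mulf_eq0 => /orP[/eqP two0 | /eqP //].
by move: char2; rewrite inE /= two0 eqxx.
Qed.

Lemma symmetric_orthogonal_basis f C U : 2%N \notin [pchar K] ->
  {in U, forall x, C x} -> has_orthogonal_basis f C U.
Proof.
move=> char2; have [n] := ubnP (\dim U); elim: n U => // n IHn U le_Un CU.
case: (classic (exists2 u, u \in U & f u u != 0)) => [[u uU fu] | f0].
  have PU : (line_proj f u @: U)%VS = <[u]>%VS by exact: limg_line_proj.
  apply: (has_orthogonal_basis_split (line_proj_self_adjoint f u)).
  - exact: line_proj_idempotent.
  - by rewrite PU -memvE.
  - rewrite PU; exists [:: u]; split => //.
      by apply: seq1_basis; apply: contraNneq fu => ->; rewrite linear0l.
    by move=> x; rewrite inE => /eqP ->; apply: CU.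
  - apply: IHn => [|x]; last by rewrite memv_cap => /andP[/CU].
    rewrite -ltnS; apply: leq_trans le_Un; rewrite ltnS.
    rewrite -(limg_ker_dim (line_proj f u) U) PU dim_vline.
    by rewrite -[X in (X < _)%N]addn0 ltn_add2l lt0b; apply: contraNneq fu => ->;
      rewrite linear0l.
(* Every vector of [U] is isotropic, so [f] vanishes on [U] and any basis is orthogonal. *)
exists (vbasis U); split; first exact: vbasisP.
  apply/(pairwiseP 0) => i j iU jU _; apply/eqP.
  apply: (isotropic_orthogonal char2 (U := U)); rewrite ?vbasis_mem ?mem_nth //.
  move=> x xU; apply/eqP; apply: contra_notT f0 => fx; first by exists x.
by move=> x /vbasis_mem /CU.
Qed.

Lemma commuting_idempotents_orthogonal_basis f (E : 'End(V) -> Prop) U :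
  2%N \notin [pchar K] ->
  (forall P, E P -> self_adjoint f P) ->
  (forall P, E P -> idempotent_lfun P) ->
  (forall P Q, E P -> E Q -> forall x, P (Q x) = Q (P x)) ->
  (forall P, E P -> (P @: U <= U)%VS) ->
  has_orthogonal_basis f (fun x => forall P, E P -> P x = x \/ P x = 0) U.
Proof.
move=> char2 Ef EE Ecomm.
have [n] := ubnP (\dim U); elim: n U => // n IHn U le_Un EU.
case: (classic (exists P, [/\ E P, (P @: U != 0)%VS & (U :&: lker P != 0)%VS])).
  move=> [P [EP PU0 kerP0]]; have dimU := limg_ker_dim P U.
  (* Both pieces are nonzero, so each has smaller dimension; both stay stable under every [Q] in [E]
     because [Q] commutes with [P]. *)
  apply: (has_orthogonal_basis_split (Ef P EP) (EE P EP) (EU P EP)).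
  - apply: IHn => [|Q EQ].
      rewrite -ltnS; apply: leq_trans le_Un; rewrite ltnS -dimU.
      by rewrite -[X in (X < _)%N]add0n ltn_add2r lt0n dimv_eq0.
    apply/subvP => _ /memv_imgP[_ /memv_imgP[x xU ->] ->].
    by rewrite -Ecomm // memv_img // (subvP (EU Q EQ)) ?memv_img.
  - apply: IHn => [|Q EQ].
      rewrite -ltnS; apply: leq_trans le_Un; rewrite ltnS -dimU.
      by rewrite -[X in (X < _)%N]addn0 ltn_add2l lt0n dimv_eq0.
    apply/subvP => _ /memv_imgP[x + ->].
    rewrite !memv_cap !memv_ker => /andP[xU /eqP Px0].
    by rewrite Ecomm // Px0 linear0 eqxx (subvP (EU Q EQ)) ?memv_img.
(* Each [P] now has zero image or zero kernel on [U], so the required property holds on all of [U],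
   whichever basis is chosen. *)
move=> no_split; apply: symmetric_orthogonal_basis => // x xU P EP.
have [PU0 | PU0] := eqVneq (P @: U)%VS 0%VS.
  by right; apply/eqP; rewrite -memv0 -PU0 memv_img.
left; have [kerP0 | kerP0] := eqVneq (U :&: lker P)%VS 0%VS; last first.
  by case: no_split; exists P.
apply/eqP; rewrite -subr_eq0 -memv0 -kerP0 memv_cap memv_ker linearB /=.
by rewrite (EE P EP) subrr eqxx memvB // (subvP (EU P EP)) ?memv_img.
Qed.

(** * Eigenprojections of diagonalizable endomorphisms *)

(** For diagonalizable [T] this determines [P]: the projection onto the [a]-eigenspace along the
    other eigenspaces, zero if [a] is not an eigenvalue. *)
Definition eigenprojection T a P : Prop :=
  forall c v, T v = c *: v -> P v = if c == a then v else 0.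

Lemma eigenprojection_exists T a :
  diagonalizable_end T -> exists P, eigenprojection T a P.
Proof.
move=> [B [BB BT]]; have Bfree := basis_free BB.
pose Pb b := if T b == a *: b then b else 0.
have [P PE] := linear_of_free B (map Pb B).
have {}PE k : P B`_k = Pb B`_k.
  have [lt_k | ge_k] := ltnP k (size B).
    by rewrite -(nth_map 0 0) // -(nth_map 0 0 Pb) // PE // size_map.
  by rewrite nth_default // linear0 /Pb linear0 scaler0 eqxx.
exists (linfun P) => c v Tv; rewrite lfunE /=.
rewrite {1 2}(coord_basis BB (memvf v)) linear_sum /=.
suff PEc k : P (coord B k v *: B`_k) = if c == a then coord B k v *: B`_k else 0.
  by rewrite (eq_bigr _ (fun k _ => PEc k)); case: eqP => // _; rewrite big1.
rewrite linearZ /= PE /Pb.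
have [-> | ck] := eqVneq (coord B k v) 0; first by rewrite !scale0r if_same.
(* Comparing [k]-th coordinates in [T v = c *: v]: an eigenvector for [c] only involves basis
   vectors with eigenvalue [c]. *)
have Tk : T B`_k = c *: B`_k.
  have [_ [d]] := BT k; rewrite (tnth_nth 0) => Td; rewrite Td.
  suff /eqP : coord B k v * (d - c) = 0.
    by rewrite mulf_eq0 (negPf ck) subr_eq0 => /eqP ->.
  have : coord B k (T v) = c * coord B k v by rewrite Tv linearZ.
  rewrite {1}(coord_basis BB (memvf v)) !linear_sum (bigD1 k) //= big1 => [|i ik].
    rewrite addr0 !linearZ /= Td linearZ /= coord_free // eqxx mulr1 => cd.
    by rewrite mulrBr cd mulrC subrr.
  have [_ [e]] := BT i; rewrite (tnth_nth 0) => Te.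
  by rewrite !linearZ /= Te linearZ /= coord_free // (negPf ik) !mulr0.
have Bk0 : B`_k != 0 by rewrite (free_not0 Bfree) ?mem_nth ?size_tuple.
rewrite Tk -subr_eq0 -scalerBl scaler_eq0 (negPf Bk0) orbF subr_eq0.
by case: eqP => _; rewrite ?scaler0.
Qed.

Lemma eq_on_eigenvectors T P Q : diagonalizable_end T ->
  (forall c v, T v = c *: v -> P v = Q v) -> P =1 Q.
Proof.
move=> [B [BB BT]] PQ x; suff -> : P = Q by [].
apply/(fullv_lfunP _ _ (span_basis BB)) => _ /tnthP[k ->].
by have [_ [c Tk]] := BT k; apply: PQ Tk.
Qed.

Lemma eigenprojection_idempotent T a P :
  diagonalizable_end T -> eigenprojection T a P -> idempotent_lfun P.
Proof.
move=> Tdiag TP x; rewrite -comp_lfunE.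
apply: (eq_on_eigenvectors Tdiag) => c v Tv; rewrite comp_lfunE (TP _ _ Tv).
by case: eqP Tv => [-> /TP | _ _]; rewrite ?eqxx ?linear0.
Qed.

(** A map commuting with [T] sends each eigenspace of [T] into itself. *)
Lemma eigenprojection_comm T a P S :
  diagonalizable_end T -> eigenprojection T a P ->
  (forall x, T (S x) = S (T x)) -> forall x, P (S x) = S (P x).
Proof.
move=> Tdiag TP TS x; rewrite -!comp_lfunE.
apply: (eq_on_eigenvectors Tdiag) => c v Tv; rewrite !comp_lfunE (TP _ _ Tv).
rewrite (TP c); first by case: eqP => // _; rewrite linear0.
by rewrite TS Tv linearZ.
Qed.

Lemma eigenspaces_orthogonal f T a b x y : self_adjoint f T ->
  T x = a *: x -> T y = b *: y -> a != b -> f x y = 0.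
Proof.
move=> Tf Tx Ty neq_ab; have /eqP := Tf x y.
rewrite Tx Ty sym_formZl sym_formZr -subr_eq0 -mulrBl mulf_eq0 subr_eq0.
by rewrite (negPf neq_ab) => /eqP.
Qed.

(** It suffices to test on an eigenbasis of [T]. If exactly one of the two eigenvalues is [a], both
    sides vanish by orthogonality of distinct eigenspaces. *)
Lemma eigenprojection_self_adjoint f T a P :
  diagonalizable_end T -> self_adjoint f T -> eigenprojection T a P ->
  self_adjoint f P.
Proof.
move=> [B [BB BT]] Tf TP x y.
rewrite (coord_basis BB (memvf x)) (coord_basis BB (memvf y)).
rewrite !(linear_sum P) !linear_sumlz; apply: eq_bigr => i _.
rewrite !linear_sumr; apply: eq_bigr => j _ /=; rewrite !(linearZ_LR P) /=.
rewrite !(sym_formZl, sym_formZr); congr (_ * (_ * _)).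
have [_ [c Ti]] := BT i; have [_ [d Tj]] := BT j.
rewrite !(tnth_nth 0) in Ti Tj; rewrite (TP _ _ Ti) (TP _ _ Tj).
have [eq_ca | neq_ca] := eqVneq c a; have [eq_da | neq_da] := eqVneq d a => //;
  rewrite ?linear0l ?linear0r //.
- by rewrite (eigenspaces_orthogonal Tf Ti Tj) // eq_ca eq_sym.
- by rewrite (eigenspaces_orthogonal Tf Ti Tj) // eq_da.
Qed.

(** Take [a] to be the eigenvalue of a basis vector occurring in [v]. Its projection keeps that
    coordinate, so it cannot kill [v]; it fixes [v], which thus lies in the [a]-eigenspace. *)
Lemma eigenprojections_eigenvector T v : diagonalizable_end T -> v != 0 ->
  (forall a P, eigenprojection T a P -> P v = v \/ P v = 0) -> eigenvector T v.
Proof.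
move=> Tdiag v0 vP; split => //; have [B [BB BT]] := Tdiag.
have [k ck] : exists k, coord B k v != 0.
  apply/existsP; apply: contraNT v0 => /existsPn c0.
  rewrite (coord_basis BB (memvf v)) big1 // => i _.
  by have := c0 i; rewrite negbK => /eqP ->; rewrite scale0r.
have [_ [a Tk]] := BT k; exists a.
have [P TP] := eigenprojection_exists a Tdiag.
have [Pv | Pv] := vP a P TP.
  have TPa : (T \o P)%VF =1 (a *: P)%VF.
    apply: (eq_on_eigenvectors Tdiag) => c x Tx.
    rewrite comp_lfunE scale_lfunE (TP _ _ Tx).
    by case: eqP Tx => [-> | _ _] //; rewrite linear0 scaler0.
  by have := TPa v; rewrite comp_lfunE scale_lfunE Pv.
case/negP: ck; have {Pv} : coord B k (P v) = 0 by rewrite Pv linear0.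
have Bfree := basis_free BB; rewrite (tnth_nth 0) in Tk.
rewrite {1}(coord_basis BB (memvf v)) !linear_sum (bigD1 k) //= big1 => [|i ik].
  rewrite addr0 !linearZ /= (TP _ _ Tk) eqxx coord_free // eqxx.
  by rewrite mulr1 => ->.
have [_ [c Ti]] := BT i; rewrite (tnth_nth 0) in Ti.
rewrite !linearZ /= (TP _ _ Ti); case: eqP => _; last by rewrite linear0 mulr0.
by rewrite coord_free // (negPf ik) mulr0.
Qed.

End SymmetricForms.

(* The index set "I together with 0" is [option I]: [F None] is < , >_0 and
   [F (Some i)] is < , >_i. *)
Theorem theorem1 (K : fieldType) (V : vectType K) (I : Type)
    (F : option I -> {symmetric V}) (F0_nondeg : nondegenerate (F None)) :
  (exists T : I -> 'End(V),
     forall (i : I) (x y : V), F (Some i) x y = F None (T i x) y) /\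
  (forall T : I -> 'End(V),
     (forall (i : I) (x y : V), F (Some i) x y = F None (T i x) y) ->
     [/\ forall i : I, self_adjoint (F None) (T i),
         simultaneously_orthogonalizable F <->
           (exists B : (\dim {:V}).-tuple V,
              [/\ is_basis B, orthogonal_wrt (F None) B &
                  forall i : I, diagonal_wrt B (T i)])
       & 2%N \notin [pchar K] ->
         (simultaneously_orthogonalizable F <->
            commutative_family T /\ (forall i : I, diagonalizable_end (T i)))]).
Proof.
split=> [|T FT].
  exists (fun i => ((flat (F None))^-1 \o flat (F (Some i)))%VF) => i.
  exact: symmetric_form_representation.
have Tsa i : self_adjoint (F None) (T i).
  by move=> x y; rewrite -FT sym_formC FT sym_formC.
have orthP : simultaneously_orthogonalizable F <->
    (exists B : (\dim {:V}).-tuple V,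
       [/\ is_basis B, orthogonal_wrt (F None) B &
           forall i : I, diagonal_wrt B (T i)]).
  split=> [[B [BB Bo]] | [B [BB Bo BT]]]; exists B; split => //.
    (* Orthogonality for the [i]-th form says that [T i] sends [tnth B j] to a vector orthogonal,
       for [F None], to the other basis vectors. *)
    move=> i; apply: (orthogonal_diagonal F0_nondeg) => // j k jk.
    by rewrite -FT Bo.
  case=> [i|] // j k jk; rewrite FT.
  by have [_ [a ->]] := BT i j; rewrite sym_formZl Bo // mulr0.
split=> // char2; rewrite orthP; split=> [[B [BB Bo BT]] | [Tcomm Tdiag]].
  split=> [i j | i]; last by exists B.
  apply/(fullv_lfunP _ _ (span_basis BB)) => _ /tnthP[k ->].
  have [_ [a Ta]] := BT i k; have [_ [b Tb]] := BT j k.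
  by rewrite !comp_lfunE Ta Tb !linearZ /= Ta Tb !scalerA mulrC.
(* All eigenprojections of all the [T i] are treated as one family. *)
pose E P := exists i a, eigenprojection (T i) a P.
have /has_orthogonal_basisT[B [BB Bo BE]] : has_orthogonal_basis (F None)
    (fun x => forall P, E P -> P x = x \/ P x = 0) fullv.
  apply: commuting_idempotents_orthogonal_basis => //.
  - move=> P [i [a]]; exact: eigenprojection_self_adjoint.
  - move=> P [i [a]]; exact: eigenprojection_idempotent.
  - move=> P Q [i [a TP]] [j [b TQ]].
    (* Commutation is transferred twice: from [T j] to its projection [Q], which then commutes with
       [T i], and from [T i] to [P]. *)
    apply: (eigenprojection_comm (Tdiag i) TP) => x; symmetry.
    apply: (eigenprojection_comm (Tdiag j) TQ) => y.
    by rewrite -!comp_lfunE Tcomm.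
  - by move=> P _; apply: subvf.
exists B; split => // i j; apply: eigenprojections_eigenvector (Tdiag i) _ _.
  exact: basis_not0 BB (mem_tnth j B).
by move=> a P TP; apply: BE; exists i, a.
Qed.
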